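(* For $j=1,2,\dots,k$, let $A_j$ be an $n_j\times n_j$ matrix with corresponding eigenvalues $\lambda_{1j},\lambda_{2j},\dots,\lambda_{n_j j}$ counted with their multiplicities. Suppose that for each $j=1,2,\dots,k$, the vector $u_j$ is an eigenvector of $A_j$ corresponding to the eigenvalue $\lambda_{1j}$ with $\|u_j\|=1$. Then, for any constants $\rho_{pq}$, where $1\le p,q\le k$, the block matrix $B=(B_{pq})_{1\le p,q\le k}$ of order $n_1+n_2+\dots+n_k$, whose diagonal blocks are $B_{pp}=A_p+\rho_{pp}u_pu_p^T$ and whose off-diagonal blocks are $B_{pq}=\rho_{pq}u_pu_q^T$ for $p\neq q$, has eigenvalues $$\lambda_{21},\lambda_{31},\dots,\lambda_{n_1 1},\ \lambda_{22},\lambda_{32},\dots,\lambda_{n_2 2},\ \dots,\ \lambda_{2k},\lambda_{3k},\dots,\lambda_{n_k k},\ \gamma_1,\gamma_2,\dots,\gamma_k,$$ where $\gamma_1,\gamma_2,\dots,\gamma_k$ are the eigenvalues of the $k\times k$ matrix $\widehat{B}$ with diagonal entries $\widehat{B}_{pp}=\lambda_{1p}+\rho_{pp}$ and off-diagonal entries $\widehat{B}_{pq}=\rho_{pq}$ for $p\neq q$.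
   Context: Here $\|\cdot\|$ is the Euclidean norm, vectors are column vectors, and $^T$ denotes the transpose. The $A_j$ are arbitrary square matrices; they are not assumed symmetric or diagonalizable. The constants $\rho_{pq}$ are arbitrary.
   Formalization: The eigenvectors u_j are assumed to have real entries (matrices, eigenvalues and constants may be complex); for non-real u_j the claim with plain transpose fails, e.g. k=1, A=0, u=(1,i)^T/√2, ρ=1. *)

(* Defs.v *)
From mathcomp Require Import all_boot all_order all_algebra.

Set Implicit Arguments.
Unset Strict Implicit.
Unset Printing Implicit Defensive.

Import Order.TTheory GRing.Theory Num.Theory.
Local Open Scope ring_scope.

(* Algebraic multiplicities; this forces [size s = n]. *)
Definition has_eigenvalues (C : fieldType) (n : nat) (M : 'M[C]_n)
    (s : seq C) : Prop :=
  char_poly M = \prod_(z <- s) ('X - z%:P).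

(* A right (column) eigenvector, whereas [eigenspace] of mxalgebra is about
   row vectors. *)
Definition is_eigenvector (C : fieldType) (n : nat) (M : 'M[C]_n)
    (a : C) (v : 'cV[C]_n) : Prop :=
  v != 0 /\ M *m v = a *: v.

Definition euclid_norm (C : numClosedFieldType) (n : nat) (v : 'cV[C]_n) : C :=
  sqrtC (\sum_i `|v i 0| ^+ 2).

(* Main.v *)
Require Import Defs.
From mathcomp Require Import all_boot all_order all_algebra.

Import Order.TTheory GRing.Theory Num.Theory.
Local Open Scope ring_scope.

(** Let [D] be the block diagonal matrix of the [A j], and let [U] be the matrix
    with [k] columns whose [j]-th column carries [u j] in the [j]-th block and
    zeros elsewhere.  Real unit vectors satisfy [(u j)^T *m u j = 1], so
    [U^T *m U = 1]; the eigenvector equations say [D *m U = U *m L], where [L]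
    is the diagonal matrix of the distinguished eigenvalues; and the matrices of
    the theorem are [B = D + U *m S *m U^T] and [Bhat = L + S] with [S] the
    matrix of the [rho p q].  Hence the columns of [U] span a space on which
    [D] acts as [L] and [B] acts as [L + S], while [D] and [B] induce the same
    map on the quotient.  On characteristic polynomials this reads
    [char_poly B * char_poly L = char_poly D * char_poly (L + S)]
    ([char_poly_intertwined_update]), and the nonzero factor [char_poly L],
    which collects exactly the distinguished eigenvalues, is cancelled from
    [char_poly D] ([char_poly_mxdiag]). *)

(** Both sides are the determinant of the product of the block matrices
    [[X, U], [W, 1]] and [[1, -U], [0, Y]]: the first has determinant
    [\det (X - U *m W)] by Schur complement, and the intertwining relation
    makes the product block triangular.  No inverse of [X] or [Y] appears, so
    the identity applies to characteristic matrices over [{poly R}]. *)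
Lemma det_sub_intertwined {R : comNzRingType} {m k : nat} (X : 'M[R]_m)
    (Y : 'M[R]_k) (U : 'M[R]_(m, k)) (W : 'M[R]_(k, m)) :
  X *m U = U *m Y ->
  \det (X - U *m W) * \det Y = \det X * \det (Y - W *m U).
Proof.
move=> XU; pose P := block_mx X U W 1%:M.
have detP : \det P = \det (X - U *m W).
  have := det_mulmx P (block_mx 1%:M 0 (- W) 1%:M).
  rewrite det_lblock !det1 !mulr1 => <-.
  rewrite mulmx_block !mulmx1 !mul1mx !mulmx0 !add0r subrr mulmxN.
  by rewrite det_ublock det1 mulr1.
have := det_mulmx P (block_mx 1%:M (- U) 0 Y).
rewrite det_ublock det1 mul1r detP => <-.
rewrite mulmx_block !mulmx1 !mul1mx !mulmx0 !addr0 !mulmxN XU addNr.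
by rewrite det_lblock [- _ + _]addrC.
Qed.

(** A matrix [U] with left inverse [V] makes [L] the restriction of [D] to an
    invariant subspace; the update [U *m S *m V] changes [L] into [L + S] there
    and does nothing modulo that subspace. *)
Lemma char_poly_intertwined_update {R : comNzRingType} {m k : nat}
    (D : 'M[R]_m) (L S : 'M[R]_k) (U : 'M[R]_(m, k)) (V : 'M[R]_(k, m)) :
  D *m U = U *m L -> V *m U = 1%:M ->
  char_poly (D + U *m S *m V) * char_poly L = char_poly D * char_poly (L + S).
Proof.
move=> DU VU; pose f : {rmorphism R -> {poly R}} := polyC.
have XU : char_poly_mx D *m map_mx f U = map_mx f U *m char_poly_mx L.
  by rewrite mulmxBl mulmxBr -!map_mxM DU scalar_mxC.
have := det_sub_intertwined _ _ _ (map_mx f (S *m V)) XU.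
rewrite -!map_mxM mulmxA -[S *m V *m U]mulmxA VU mulmx1.
by rewrite /char_poly /char_poly_mx !map_mxD !opprD !addrA.
Qed.

Lemma char_poly_castmx {R : nzRingType} {m n : nat} (e : m = n) (M : 'M[R]_m) :
  char_poly (castmx (e, e) M) = char_poly M.
Proof. by case: n / e. Qed.

Lemma char_poly_mxdiag {R : comNzRingType} {k : nat} {n : 'I_k -> nat}
    (A : forall j, 'M[R]_(n j)) :
  char_poly (\mxdiag_j A j) = \prod_j char_poly (A j).
Proof.
elim: k n A => [|k IHk] n A.
  have e : (\sum_(j < 0) n j)%N = 0%N by rewrite big_ord0.
  by rewrite -(char_poly_castmx e) /char_poly det_mx00 big_ord0.
rewrite mxdiag_recl char_poly_castmx big_ord_recl -IHk /char_poly.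
by rewrite char_block_diag_mx det_ublock.
Qed.

(** Realness turns the Hermitian norm into the bilinear form [v^T *m v]. *)
Lemma mul_trmx_real_unit {C : numClosedFieldType} {n : nat} (v : 'cV[C]_n) :
  v \is a mxOver Num.real -> euclid_norm v = 1 -> v^T *m v = 1%:M.
Proof.
move=> /mxOverP v_real v_norm.
have {}v_norm : \sum_i `|v i 0| ^+ 2 = 1.
  by rewrite -[LHS]sqrtCK -/(euclid_norm v) v_norm expr1n.
apply/matrixP=> i j; rewrite !ord1 !mxE eqxx -[RHS]v_norm.
by apply: eq_bigr => l _; rewrite mxE real_normK ?expr2.
Qed.

(** The direct sum of the [u j].  Its columns are indexed by ['I_k] itself,
    not by the size [\sum_(j < k) 1] that [\mxblock] would give,
    so that it multiplies [k] by [k] matrices without casts. *)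
Definition block_columns {R : comNzRingType} {k : nat} {n : 'I_k -> nat}
    (u : forall j, 'cV[R]_(n j)) :
    'M[R]_(\sum_(j < k) n j, k) :=
  \mxcol_i (u i *m delta_mx 0 i).

Lemma block_columns_orthonormal {R : comNzRingType} {k : nat} {n : 'I_k -> nat}
    (u : forall j, 'cV[R]_(n j)) :
  (forall j, (u j)^T *m u j = 1%:M) ->
  (block_columns u)^T *m block_columns u = 1%:M.
Proof.
move=> uu; rewrite tr_mxcol mul_mxrow_mxcol mx1_sum_delta.
apply: eq_bigr => j _.
by rewrite trmx_mul mulmxA -[_ *m u j]mulmxA uu mulmx1 trmx_delta mul_delta_mx.
Qed.

Lemma mxdiag_mul_block_columns {R : comNzRingType} {k : nat} {n : 'I_k -> nat}
    (u : forall j, 'cV[R]_(n j)) (A : forall j, 'M[R]_(n j)) (d : 'I_k -> R) :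
  (forall j, A j *m u j = d j *: u j) ->
  (\mxdiag_j A j) *m block_columns u =
    block_columns u *m diag_mx (\row_j d j).
Proof.
move=> Au; rewrite mul_mxdiag_mxcol mxcol_mul; apply: eq_mxcol => j.
rewrite mulmxA Au -mulmxA -scalemxAl scalemxAr; congr (_ *m _).
apply/matrixP=> a b; rewrite mul_mx_diag !mxE mulrC.
by case: (b =P j) => [->|_]; rewrite ?andbF ?mul0r.
Qed.

(** All the rank-one blocks together form one matrix factoring through [k]
    dimensions, to which the low-rank update formula applies. *)
Lemma block_columns_sandwich {R : comNzRingType} {k : nat} {n : 'I_k -> nat}
    (u : forall j, 'cV[R]_(n j)) (S : 'M[R]_k) :
  block_columns u *m S *m (block_columns u)^T =
    \mxblock_(p, q) (S p q *: (u p *m (u q)^T)).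
Proof.
rewrite mxcol_mul tr_mxcol mul_mxcol_mxrow; apply: eq_mxblock => p q.
rewrite trmx_mul trmx_delta -!mulmxA -rowE mulmxA -colE.
rewrite row_mul scalemxAr -mul_scalar_mx; congr (_ *m (_ *m _)).
by apply/matrixP=> a b; rewrite !ord1 !mxE eqxx.
Qed.

Theorem theorem2p3 (C : numClosedFieldType) (k : nat) (n : 'I_k -> nat)
    (A : forall j : 'I_k, 'M[C]_(n j))
    (lam : forall j : 'I_k, (n j).-tuple C)
    (lamP : forall j : 'I_k, has_eigenvalues (A j) (lam j))
    (u : forall j : 'I_k, 'cV[C]_(n j))
    (u_real : forall j : 'I_k, u j \is a mxOver Num.real)
    (u_eig : forall j : 'I_k, is_eigenvector (A j) (head 0 (lam j)) (u j))
    (u_norm : forall j : 'I_k, euclid_norm (u j) = 1)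
    (rho : 'I_k -> 'I_k -> C)
    (B : 'M[C]_(\sum_(j < k) n j))
    (B_diag : forall p : 'I_k,
       submxblock B p p = A p + rho p p *: (u p *m (u p)^T))
    (B_off : forall p q : 'I_k, p != q ->
       submxblock B p q = rho p q *: (u p *m (u q)^T))
    (Bhat : 'M[C]_k)
    (Bhat_diag : forall p : 'I_k, Bhat p p = head 0 (lam p) + rho p p)
    (Bhat_off : forall p q : 'I_k, p != q -> Bhat p q = rho p q)
    (gamma : k.-tuple C)
    (gammaP : has_eigenvalues Bhat gamma) :
  has_eigenvalues B
    (flatten [seq behead (lam j) | j <- enum 'I_k] ++ gamma).
Proof.
have lamE j : lam j = head 0 (lam j) :: behead (lam j) :> seq C.
  case: (tval (lam j)) (size_tuple (lam j)) => [n0|//].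
  (* An eigenvector lives in positive dimension. *)
  case: (u_eig j) => /eqP[]; apply/matrixP=> i.
  by have := ltn_ord i; rewrite -{2}n0.
pose d j := head 0 (lam j); pose S := \matrix_(p, q) rho p q.
pose U := block_columns u.
have BE : B = \mxdiag_j A j + U *m S *m U^T.
  rewrite block_columns_sandwich; apply/mxblockP => p q.
  rewrite submxblockD !mxblockK mxE.
  case: eqVneq => [<-|pq]; last by rewrite B_off ?add0r.
  by rewrite conform_mx_id B_diag.
have BhatE : Bhat = diag_mx (\row_j d j) + S.
  apply/matrixP=> p q; rewrite !mxE.
  case: eqVneq => [<-|pq]; last by rewrite Bhat_off ?add0r.
  by rewrite Bhat_diag.
have charL : char_poly (diag_mx (\row_j d j)) = \prod_j ('X - (d j)%:P).
  rewrite char_poly_trig ?diag_mx_is_trig //.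
  by apply: eq_bigr => j _; rewrite !mxE eqxx.
have charL_neq0 : char_poly (diag_mx (\row_j d j)) != 0.
  exact: monic_neq0 (char_poly_monic _).
apply: (mulIf charL_neq0); rewrite BE char_poly_intertwined_update; first last.
- by apply: block_columns_orthonormal => j; apply: mul_trmx_real_unit.
- by apply: mxdiag_mul_block_columns => j; case: (u_eig j).
rewrite -BhatE gammaP char_poly_mxdiag charL big_cat big_flatten big_map /=.
rewrite big_enum /= mulrAC; congr (_ * _); rewrite -big_split /=.
by apply: eq_bigr => j _; rewrite lamP lamE big_cons mulrC.
Qed.
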